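(* (1) There is no LTL formula $\varphi$ such that, for $\star=s$ or for $\star=a$, for all teams $T$: $T\models_\star\varphi$ iff $T\models\exists\pi.\,p_\pi$ (HyperLTL). (2) There is no HyperLTL sentence $\phi$ such that for all teams $T$: $T\models\phi$ iff $T\models_s Fp$. (3) LTL under asynchronous team semantics is exactly as expressive as $\forall$-HyperLTL: for every LTL formula $\varphi$ there is a $\forall$-HyperLTL sentence $\phi$ with $T\models_a\varphi\iff T\models\phi$ for all teams $T$, and for every $\forall$-HyperLTL sentence $\phi$ there is an LTL formula $\varphi$ with the same property.
   Context: Fix a finite set $AP$ with $p\in AP$. Traces are elements of $(2^{AP})^\omega$, $t[i,\infty)=t(i)t(i+1)\cdots$; teams are sets of traces, $T[i,\infty)=\{t[i,\infty):t\in T\}$, $T[k]=\{t[k(t),\infty):t\in T\}$ for $k:T\to\mathbb N$. LTL formulas: $\varphi::=p\mid\neg p\mid\varphi\wedge\varphi\mid\varphi\vee\varphi\mid X\varphi\mid F\varphi\mid G\varphi\mid\varphi U\varphi\mid\varphi R\varphi$. Team semantics $\models_\star$, $\star\in\{a,s\}$: $T\models_\star p$ iff $p\in t(0)$ for all $t\in T$; $T\models_\star\neg p$ iff $p\notin t(0)$ for all $t\in T$; $\wedge$ conjunctive; $T\models_\star\psi\vee\varphi$ iff $T=T_1\cup T_2$ with $T_1\models_\star\psi$, $T_2\models_\star\varphi$; $T\models_\star X\varphi$ iff $T[1,\infty)\models_\star\varphi$. Synchronous: $T\models_s F\varphi$ iff $\exists k$: $T[k,\infty)\models_s\varphi$;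 $G$: $\forall k$; $T\models_s\psi U\varphi$ iff $\exists k$: $T[k,\infty)\models_s\varphi$ and $\forall k'<k$: $T[k',\infty)\models_s\psi$; $T\models_s\psi R\varphi$ iff $\forall k$: $T[k,\infty)\models_s\varphi$ or $\exists k'<k$: $T[k',\infty)\models_s\psi$. Asynchronous: $T\models_a F\varphi$ iff $\exists k:T\to\mathbb N$ with $T[k]\models_a\varphi$; $T\models_a G\varphi$ iff $T[k]\models_a\varphi$ for all $k$; $T\models_a\psi U\varphi$ iff there is $k$ with $T[k]\models_a\varphi$ such that for $T_>=\{t:k(t)>0\}$ and all $k':T_>\to\mathbb N$, $k'<k$ pointwise, $\{t[k'(t),\infty):t\in T_>\}\models_a\psi$; $T\models_a\psi R\varphi$ iff for every $k:T\to\mathbb N$ there are $T_1\cup T_2=T$ with $\{t[k(t),\infty):t\in T_1\}\models_a\varphi$ and some $k':T_2\to\mathbb N$, $k'<k$ pointwise, with $\{t[k'(t),\infty):t\in T_2\}\models_a\psi$. HyperLTL: formulas $\phi::=\exists\pi.\phi\mid\forall\pi.\phi\mid\psi$, $\psi::=p_\pi\mid\neg\psi\mid\psi\vee\psi\mid X\psi\mid\psi U\psi$, with $p\in AP$ and $\pi$ from a countable set of trace variables; a sentence has no free trace variables. For a team $T$ and a partial assignment $\Pi$ of trace variables to traces ($\Pi^i$ maps each $\pi$ to $\Pi(\pi)[i,\infty)$): $(T,\Pi)\models p_\pi$ iff $p\in\Pi(\pi)(0)$; $\neg,\vee$ classical; $(T,\Pi)\models X\psi$ iff $(T,\Pi^1)\models\psi$;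 $(T,\Pi)\models\psi_1U\psi_2$ iff $\exists k$: $(T,\Pi^k)\models\psi_2$ and $\forall k'<k$: $(T,\Pi^{k'})\models\psi_1$; $(T,\Pi)\models\exists\pi.\psi$ iff for some $t\in T$, $(T,\Pi[\pi\mapsto t])\models\psi$; $\forall$ dually. $T\models\phi$ means $(T,\Pi_\emptyset)\models\phi$ for the empty assignment. $\forall$-HyperLTL is the set of sentences $\forall\pi.\psi$ with $\psi$ quantifier-free. *)

(* Defs.v *)
From mathcomp Require Import all_boot.
Set Implicit Arguments. Unset Strict Implicit. Unset Printing Implicit Defensive.

Section Defs.
Variable AP : finType.

(** Traces (2^AP)^omega, represented as nat -> (AP -> bool);
    t i a = true  iff  a \in t(i). *)
Definition trace := nat -> AP -> bool.
Definition team := trace -> Prop.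

Definition tshift (i : nat) (t : trace) : trace := fun n => t (i + n).

Definition timg (T : team) (f : trace -> trace) : team :=
  fun t' => exists t, T t /\ t' = f t.

Definition tsuffix (T : team) (i : nat) : team := timg T (tshift i).
(** T[k] for k : T -> N (given as a total function; only values on T matter) *)
Definition tsuffixk (T : team) (k : trace -> nat) : team :=
  timg T (fun t => tshift (k t) t).

Inductive ltl :=
| LAP of AP
| LNAP of AP
| LAnd of ltl & ltl
| LOr of ltl & ltl
| LX of ltl
| LF of ltl
| LG of ltl
| LU of ltl & ltl
| LR of ltl & ltl.

Fixpoint sat_s (T : team) (phi : ltl) : Prop :=
  match phi with
  | LAP a => forall t, T t -> t 0 a = true
  | LNAP a => forall t, T t -> t 0 a = false
  | LAnd f g => sat_s T f /\ sat_s T g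
  | LOr f g => exists T1 T2 : team,
      (forall t, T t <-> (T1 t \/ T2 t)) /\ sat_s T1 f /\ sat_s T2 g
  | LX f => sat_s (tsuffix T 1) f
  | LF f => exists k, sat_s (tsuffix T k) f
  | LG f => forall k, sat_s (tsuffix T k) f
  | LU f g => exists k, sat_s (tsuffix T k) g /\
                forall k', k' < k -> sat_s (tsuffix T k') f
  | LR f g => forall k, sat_s (tsuffix T k) g \/
                exists k', k' < k /\ sat_s (tsuffix T k') f
  end.

Fixpoint sat_a (T : team) (phi : ltl) : Prop :=
  match phi with
  | LAP a => forall t, T t -> t 0 a = true
  | LNAP a => forall t, T t -> t 0 a = false
  | LAnd f g => sat_a T f /\ sat_a T g
  | LOr f g => exists T1 T2 : team,
      (forall t, T t <-> (T1 t \/ T2 t)) /\ sat_a T1 f /\ sat_a T2 g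
  | LX f => sat_a (tsuffix T 1) f
  | LF f => exists k : trace -> nat, sat_a (tsuffixk T k) f
  | LG f => forall k : trace -> nat, sat_a (tsuffixk T k) f
  | LU f g => exists k : trace -> nat, sat_a (tsuffixk T k) g /\
      forall k' : trace -> nat,
        (forall t, T t -> 0 < k t -> k' t < k t) ->
        sat_a (tsuffixk (fun t => T t /\ 0 < k t) k') f
  | LR f g => forall k : trace -> nat, exists T1 T2 : team,
      (forall t, T t <-> (T1 t \/ T2 t)) /\
      sat_a (tsuffixk T1 k) g /\
      exists k' : trace -> nat, (forall t, T2 t -> k' t < k t) /\
        sat_a (tsuffixk T2 k') f
  end.

Definition tvar := nat.

Inductive hbody :=
| HAP of AP & tvar
| HNeg of hbody
| HOr of hbody & hbody
| HX of hbody
| HU of hbody & hbody.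

Inductive hyper :=
| HEx of tvar & hyper
| HAll of tvar & hyper
| HBody of hbody.

Definition assign := tvar -> option trace.
Definition empty_assign : assign := fun _ => None.
Definition ashift (i : nat) (P : assign) : assign :=
  fun x => omap (tshift i) (P x).
Definition aupd (P : assign) (x : tvar) (t : trace) : assign :=
  fun y => if y == x then Some t else P y.

(** p_pi with pi unassigned is false (never happens for sentences) *)
Fixpoint hsat_body (T : team) (P : assign) (psi : hbody) : Prop :=
  match psi with
  | HAP a x => match P x with Some t => t 0 a = true | None => False end
  | HNeg f => ~ hsat_body T P f
  | HOr f g => hsat_body T P f \/ hsat_body T P g
  | HX f => hsat_body T (ashift 1 P) f
  | HU f g => exists k, hsat_body T (ashift k P) g /\
                forall k', k' < k -> hsat_body T (ashift k' P) f
  end.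

Fixpoint hsat_ (T : team) (P : assign) (phi : hyper) : Prop :=
  match phi with
  | HEx x f => exists t, T t /\ hsat_ T (aupd P x t) f
  | HAll x f => forall t, T t -> hsat_ T (aupd P x t) f
  | HBody psi => hsat_body T P psi
  end.

Definition hsat (T : team) (phi : hyper) : Prop := hsat_ T empty_assign phi.

Fixpoint fv_body (psi : hbody) : seq tvar :=
  match psi with
  | HAP _ x => [:: x]
  | HNeg f | HX f => fv_body f
  | HOr f g | HU f g => fv_body f ++ fv_body g
  end.

Fixpoint closed_in (bound : seq tvar) (phi : hyper) : bool :=
  match phi with
  | HEx x f | HAll x f => closed_in (x :: bound) f
  | HBody psi => all (fun x => x \in bound) (fv_body psi)
  end.

Definition sentence (phi : hyper) : bool := closed_in [::] phi.

Definition forall_hyper (phi : hyper) : Prop :=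
  sentence phi /\ exists x psi, phi = HAll x (HBody psi).

End Defs.

(* Main.v *)
Require Import Defs.
From mathcomp Require Import all_boot.
From Stdlib Require Import Classical ClassicalEpsilon FunctionalExtensionality.
Set Implicit Arguments. Unset Strict Implicit. Unset Printing Implicit Defensive.

(** Part (1): every LTL formula holds in the empty team.

    Part (3): asynchronous satisfaction is flat (a team satisfies a formula iff
    each of its traces does, in the usual LTL semantics), so it amounts to one
    universally quantified trace; negations are pushed to the literals using the
    duality of U and R.

    Part (2): given a sentence with m quantifiers, take m + 1 traces, of which
    exactly one violates p at each time; such a team is a word over the m + 1
    trace indices.  A quantifier-free formula inspects at most m of the traces,
    and to these an inserted time at which all traces satisfy p looks like a time
    at which an uninspected trace violates p.  Every quantifier-free formula has
    a synchronizing word x: on words y x w in which x recurs forever its truth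
    depends on y only.  Placed right after a word that synchronizes all the
    instances of the body, the extra time goes unnoticed by the sentence,
    although it makes F p true. *)

(** * Satisfaction by the empty team *)

Section EmptyTeam.
Variable AP : finType.
Implicit Types (T : team AP) (f : ltl AP).

Lemma timg_empty T h : (forall t, ~ T t) -> forall t, ~ timg T h t.
Proof. by move=> T0 t [t' [/T0]]. Qed.

Lemma sat_s_empty f T : (forall t, ~ T t) -> sat_s T f.
Proof.
elim: f T => [a|a|f IHf g IHg|f IHf g IHg|f IHf|f IHf|f IHf|f IHf g IHg
  |f IHf g IHg] T T0 /=; try by move=> t /T0.
- by split; [apply: IHf | apply: IHg].
- by exists T, T; split; [move=> t; tauto | split; [apply: IHf | apply: IHg]].
- exact/IHf/timg_empty.
- by exists 0; apply/IHf/timg_empty.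
- by move=> k; apply/IHf/timg_empty.
- by exists 0; split=> [|k' //]; apply/IHg/timg_empty.
- by move=> k; left; apply/IHg/timg_empty.
Qed.

End EmptyTeam.

(** * Flatness of the asynchronous semantics, and translations to and from one-variable bodies *)

Section Flatness.
Variable AP : finType.
Implicit Types (T : team AP) (t : trace AP).

Fixpoint ltl_sat t (f : ltl AP) : Prop :=
  match f with
  | LAP a => t 0 a = true
  | LNAP a => t 0 a = false
  | LAnd f g => ltl_sat t f /\ ltl_sat t g
  | LOr f g => ltl_sat t f \/ ltl_sat t g
  | LX f => ltl_sat (tshift 1 t) f
  | LF f => exists k, ltl_sat (tshift k t) f
  | LG f => forall k, ltl_sat (tshift k t) f
  | LU f g => exists k, ltl_sat (tshift k t) g /\
                forall k', k' < k -> ltl_sat (tshift k' t) f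
  | LR f g => forall k, ltl_sat (tshift k t) g \/
                exists k', k' < k /\ ltl_sat (tshift k' t) f
  end.

Lemma choice_on T (P : trace AP -> nat -> Prop) :
  (forall t, T t -> exists k, P t k) ->
  exists h : trace AP -> nat, forall t, T t -> P t (h t).
Proof.
move=> exP; exists (fun t => epsilon (inhabits 0) (P t)) => t /exP.
exact: epsilon_spec.
Qed.

Lemma flat_timg f (flatf : forall T, sat_a T f <-> (forall t, T t -> ltl_sat t f)) T h :
  sat_a (timg T h) f <-> (forall t, T t -> ltl_sat (h t) f).
Proof.
rewrite flatf; split=> H t; first by move=> Tt; apply: H; exists t.
by case=> t' [Tt' ->]; apply: H.
Qed.

(** Asynchronous time functions treat the traces independently, so instants can be picked trace by
    trace with [choice_on]. Conversely, a given instant of one trace is tested with a time function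
    that is constant, or as constant as its bound allows. *)
Lemma sat_a_flat f T : sat_a T f <-> (forall t, T t -> ltl_sat t f).
Proof.
elim: f T => [a|a|f IHf g IHg|f IHf g IHg|f IHf|f IHf|f IHf|f IHf g IHg
  |f IHf g IHg] T; rewrite /= /tsuffix /tsuffixk //.
- rewrite IHf IHg; split=> [[Hf Hg] t Tt|H]; first by split; auto.
  by split=> t /H [].
- split=> [[T1 [T2 [TE [/IHf H1 /IHg H2]]]] t /TE [/H1|/H2]|H]; try tauto.
  exists (fun t => T t /\ ltl_sat t f), (fun t => T t /\ ltl_sat t g).
  split; first by move=> t; split=> [Tt|]; [case: (H t Tt) | ]; tauto.
  by split; [apply/IHf | apply/IHg] => t [].
- by rewrite (flat_timg IHf).
- split=> [[k /(flat_timg IHf) H] t /H|/choice_on [k H]]; first by exists (k t).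
  by exists k; apply/(flat_timg IHf).
- split=> [H t Tt k|H k]; last by apply/(flat_timg IHf) => t /H.
  by move: t Tt; apply/(flat_timg IHf); apply: (H (fun=> k)).
- split=> [[k [/(flat_timg IHg) Hg Hf]] t Tt|/choice_on [k H]].
    exists (k t); split=> [|j ltjk]; first exact: Hg.
    (* The time function tested is [j] where it lies below [k] and 0 elsewhere: it is admissible on
       all traces with positive [k], and equals [j] at [t]. *)
    have ltk s : T s -> 0 < k s -> (if j < k s then j else 0) < k s.
      by move=> _; case: ifP.
    have /(flat_timg IHf) Hj := Hf _ ltk.
    by have := Hj t; rewrite ltjk; apply; split=> //; apply: leq_ltn_trans ltjk.
  exists k; split; first by apply/(flat_timg IHg) => t /H [].
  move=> k' ltk'; apply/(flat_timg IHf) => t [Tt k0].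
  by have [_] := H t Tt; apply; apply: ltk'.
- split=> [H t Tt k|H k].
    have [T1 [T2 [TE [/(flat_timg IHg) Hg [k' [ltk' /(flat_timg IHf) Hf]]]]]] :=
      H (fun=> k).
    case: (proj1 (TE t) Tt) => [/Hg|T2t]; first by left.
    by right; exists (k' t); split; [apply: ltk' | apply: Hf].
  (* Each trace joins the side that it justifies: [g] at its own time, or [f] strictly earlier. *)
  exists (fun t => T t /\ ltl_sat (tshift (k t) t) g),
    (fun t => T t /\ exists j, j < k t /\ ltl_sat (tshift j t) f).
  split; first by move=> t; split=> [Tt|]; [case: (H t Tt (k t)) | ]; tauto.
  split; first by apply/(flat_timg IHg) => t [].
  have /choice_on [k' Hk'] : forall t,
      T t /\ (exists j, j < k t /\ ltl_sat (tshift j t) f) ->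
    exists j, j < k t /\ ltl_sat (tshift j t) f by move=> t [].
  exists k'; split; first by move=> t /Hk' [].
  by apply/(flat_timg IHf) => t /Hk' [].
Qed.

Lemma sat_a_empty f T : (forall t, ~ T t) -> sat_a T f.
Proof. by move=> T0; apply/sat_a_flat => t /T0. Qed.

Definition assign1 (x : tvar) t : assign AP := aupd (empty_assign AP) x t.

Lemma ashift_assign1 i x t : ashift i (assign1 x t) = assign1 x (tshift i t).
Proof.
by apply: functional_extensionality => y; rewrite /ashift /assign1 /aupd; case: eqP.
Qed.

(** Bodies have no constant for truth, so an atom has to be supplied to express F and G through
    U. *)
Definition htrue (a : AP) := HOr (HAP a 0) (HNeg (HAP a 0)).

Fixpoint hbody_of_ltl (p : AP) (f : ltl AP) : hbody AP :=
  match f with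
  | LAP a => HAP a 0
  | LNAP a => HNeg (HAP a 0)
  | LAnd f g => HNeg (HOr (HNeg (hbody_of_ltl p f)) (HNeg (hbody_of_ltl p g)))
  | LOr f g => HOr (hbody_of_ltl p f) (hbody_of_ltl p g)
  | LX f => HX (hbody_of_ltl p f)
  | LF f => HU (htrue p) (hbody_of_ltl p f)
  | LG f => HNeg (HU (htrue p) (HNeg (hbody_of_ltl p f)))
  | LU f g => HU (hbody_of_ltl p f) (hbody_of_ltl p g)
  | LR f g => HNeg (HU (HNeg (hbody_of_ltl p f)) (HNeg (hbody_of_ltl p g)))
  end.

Lemma fv_hbody_of_ltl (p : AP) (f : ltl AP) : all (fun x => x \in [:: 0]) (fv_body (hbody_of_ltl p f)).
Proof. by elim: f => //= f IHf g IHg; rewrite all_cat IHf IHg. Qed.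

Lemma hsat_hbody_of_ltl (p : AP) f T t :
  hsat_body T (assign1 0 t) (hbody_of_ltl p f) <-> ltl_sat t f.
Proof.
elim: f t => [a|a|f IHf g IHg|f IHf g IHg|f IHf|f IHf|f IHf|f IHf g IHg
  |f IHf g IHg] t; cbn [hbody_of_ltl htrue hsat_body ltl_sat].
- by [].
- by cbn; case: (t 0 a); split.
- by rewrite IHf IHg; tauto.
- by rewrite IHf IHg.
- by rewrite ashift_assign1.
- split=> [[k [+ _]]|[k Hk]]; first by rewrite ashift_assign1 IHf; exists k.
  exists k; split; first by rewrite ashift_assign1 IHf.
  by move=> k' _; apply: classic.
- split=> [H k|H [k []]]; last by rewrite ashift_assign1 IHf.
  apply: NNPP => Hk; apply: H; exists k.
  split; first by rewrite ashift_assign1 IHf.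
  by move=> k' _; apply: classic.
- by split=> -[k [Hg Hf]]; exists k; split=> [|k' /Hf];
    move: Hg; rewrite ?ashift_assign1 ?IHf ?IHg.
- split=> [H k|H [k]].
    apply: NNPP => Hk; apply: H; exists k; split=> [|k' ltk'].
      by rewrite ashift_assign1 IHg; tauto.
    by rewrite ashift_assign1 IHf => Hf; apply: Hk; right; exists k'.
  rewrite ashift_assign1 IHg => -[Hg Hf]; case: (H k) => // -[k' [ltk' fk']].
  by apply: (Hf k' ltk'); rewrite ashift_assign1 IHf.
Qed.

(** Negation normal form: [b] is the polarity, and [false] yields the translation of the negated
    body. Variables are dropped, as a closed body under one quantifier mentions only one. *)
Fixpoint ltl_of_hbody (b : bool) (f : hbody AP) : ltl AP :=
  match f with
  | HAP a _ => if b then LAP a else LNAP a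
  | HNeg f => ltl_of_hbody (~~ b) f
  | HOr f g => if b then LOr (ltl_of_hbody b f) (ltl_of_hbody b g)
               else LAnd (ltl_of_hbody b f) (ltl_of_hbody b g)
  | HX f => LX (ltl_of_hbody b f)
  | HU f g => if b then LU (ltl_of_hbody b f) (ltl_of_hbody b g)
              else LR (ltl_of_hbody b f) (ltl_of_hbody b g)
  end.

Lemma ltl_sat_of_hbody x T b f t : all (fun y => y \in [:: x]) (fv_body f) ->
  ltl_sat t (ltl_of_hbody b f) <->
  (if b then hsat_body T (assign1 x t) f else ~ hsat_body T (assign1 x t) f).
Proof.
elim: f b t => [a y|f IHf|f IHf g IHg|f IHf|f IHf g IHg] b t /=.
- rewrite /assign1 /aupd andbT inE => ->.
  by case: b => //=; case: (t 0 a); split.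
- by move=> fvf; rewrite IHf //; case: b => /=; tauto.
- rewrite all_cat => /andP[fvf fvg].
  by case: b => /=; rewrite IHf // IHg //; tauto.
- by move=> fvf; rewrite IHf // ashift_assign1.
- rewrite all_cat => /andP[fvf fvg].
  case: b => /=.
    by split=> -[k [Hg Hf]]; exists k; split=> [|k' /Hf];
      move: Hg; rewrite ?ashift_assign1 ?IHf ?IHg.
  split=> [H [k]|H k].
    rewrite ashift_assign1 => -[Hg Hf].
    case: (H k) => [|[k' [ltk']]]; first by rewrite IHg.
    by rewrite IHf // -ashift_assign1 => /(_ (Hf _ ltk')).
  apply: NNPP => Hk; apply: H; exists k; split=> [|k' ltk'];
    rewrite ashift_assign1; apply: NNPP => Hn; apply: Hk.
    by left; rewrite IHg.
  by right; exists k'; rewrite IHf.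
Qed.

Lemma ltl_to_forall_hyper (p : AP) f : exists psi : hyper AP,
  forall_hyper psi /\ forall T, sat_a T f <-> hsat T psi.
Proof.
exists (HAll 0 (HBody (hbody_of_ltl p f))); split=> [|T].
  by split; [apply: fv_hbody_of_ltl | exists 0, (hbody_of_ltl p f)].
rewrite sat_a_flat.
by split=> H t /H; rewrite /= -/(assign1 0 t) hsat_hbody_of_ltl.
Qed.

Lemma forall_hyper_to_ltl (psi : hyper AP) : forall_hyper psi ->
  exists f, forall T, sat_a T f <-> hsat T psi.
Proof.
case=> cl [x [f def]]; move: cl; rewrite def => cl.
exists (ltl_of_hbody true f) => T; rewrite sat_a_flat.
by split=> H t /H; rewrite /= -/(assign1 x t) (ltl_sat_of_hbody T true t cl).
Qed.

End Flatness.

(** * Infinite words in which a finite word recurs *)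

Section Words.
Variable A : Type.
Implicit Types (s x y : seq A) (w : nat -> A).

Definition wshift k w : nat -> A := fun n => w (k + n).

Fixpoint catw s w : nat -> A :=
  if s is a :: s' then fun k => if k is k'.+1 then catw s' w k' else a else w.

Lemma wshiftD i j w : wshift i (wshift j w) = wshift (j + i) w.
Proof. by apply: functional_extensionality => n; rewrite /wshift addnA. Qed.

Lemma catwA s s' w : catw (s ++ s') w = catw s (catw s' w).
Proof. by elim: s => //= a s ->. Qed.

Lemma wshift_catw k s w : k <= size s -> wshift k (catw s w) = catw (drop k s) w.
Proof. by elim: s k => [|a s IHs] [|k] //= /IHs. Qed.

Lemma wshift_catw_size s k w : wshift (size s + k) (catw s w) = wshift k w.
Proof. by elim: s => //= a s <-. Qed.

Definition recurs x w := forall k, exists y w', wshift k w = catw y (catw x w').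

Lemma recurs_wshift x k w : recurs x w -> recurs x (wshift k w).
Proof. by move=> rw i; rewrite wshiftD; apply: rw. Qed.

Lemma recurs_catw x s w : recurs x w -> recurs x (catw s w).
Proof.
move=> rw k; have [le_ks|/ltnW le_sk] := leqP k (size s); last first.
  by rewrite -(subnKC le_sk) wshift_catw_size; apply: rw.
have [y [w' Ew]] := rw 0; exists (drop k s ++ y), w'.
by rewrite wshift_catw // catwA -Ew.
Qed.

Lemma recurs_factor a x b w : recurs (a ++ x ++ b) w -> recurs x w.
Proof.
move=> rw k; have [y [w' ->]] := rw k.
by exists (y ++ a), (catw b w'); rewrite !catwA.
Qed.

Lemma recurs_suffix x w k : recurs x w ->
  exists y w', recurs x w' /\ wshift k w = catw y (catw x w').
Proof.
move=> rw; have [y [w' Ew]] := rw k; exists y, w'; split=> //.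
have := recurs_wshift (size (y ++ x) + 0) (recurs_wshift k rw).
by rewrite Ew -catwA wshift_catw_size.
Qed.

Lemma catwE a s w k : catw s w k = if k < size s then nth a s k else w (k - size s).
Proof. by elim: s k => [|b s IHs] [|k] //=; rewrite ?subn0 // IHs ltnS subSS. Qed.

Lemma recurs_exists x (a : A) : exists w, recurs x w.
Proof.
(* The extra letter keeps the period nonempty even if [x] is empty. *)
pose X := rcons x a; pose w k := nth a X (k %% size X).
have X0 : 0 < size X by rewrite size_rcons.
have wE : w = catw X w.
  apply: functional_extensionality => k; rewrite (catwE a) /w.
  by have [/modn_small -> //|leXk] := ltnP k (size X); rewrite -{1}(subnK leXk) modnDr.
exists w; apply: (@recurs_factor [::] x [:: a]); rewrite cats1 -/X => k.
(* Within the first period, finish it and read the next one; beyond it, step back by one period. *)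
elim/ltn_ind: k => k IHk; have [lekX|/ltnW leXk] := leqP k (size X).
  by exists (drop k X), w; rewrite -wE wE wshift_catw -?wE.
have [|y [w' Ew]] := IHk (k - size X); first by rewrite ltn_subrL X0 (leq_trans X0).
by exists y, w'; rewrite -Ew {1}wE -{1}(subnKC leXk) wshift_catw_size.
Qed.

End Words.

Lemma catw_map (A B : Type) (h : B -> A) (s : seq B) (w : nat -> B) :
  (fun k => h (catw s w k)) = catw (map h s) (fun k => h (w k)).
Proof.
apply: functional_extensionality => k.
by elim: s k => [|b s IHs] [|k] /=.
Qed.

(** * Synchronizing words of quantifier-free formulas *)

Section Synchronization.
Variables (AP : finType) (A : Type) (a0 : A).
Implicit Types (f g : hbody AP) (T : team AP) (x y : seq A) (w : nat -> A).
Implicit Types view : tvar -> option (A -> AP -> bool).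

(** All assigned traces are letterwise images of a single word, so that shifting the assignment is
    shifting that word. *)
Definition wassign view w : assign AP := fun i => omap (fun v (k : nat) => v (w k)) (view i).

Lemma ashift_wassign view k w : ashift k (wassign view w) = wassign view (wshift k w).
Proof.
by apply: functional_extensionality => i; rewrite /ashift /wassign; case: (view i).
Qed.

(** One implication gives the equivalence, since [w] and [w'] can be exchanged. *)
Definition synchronizes T view x f := forall y w w', recurs x w -> recurs x w' ->
  hsat_body T (wassign view (catw y (catw x w))) f ->
  hsat_body T (wassign view (catw y (catw x w'))) f.

Lemma synchronizes_factor T view a x b f :
  synchronizes T view x f -> synchronizes T view (a ++ x ++ b) f.
Proof.
move=> sx y w w' /recurs_factor rw /recurs_factor rw'.
rewrite !catwA -!(catwA y); apply: sx; exact: recurs_catw.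
Qed.

Lemma synchronizes_catl T view a x f :
  synchronizes T view x f -> synchronizes T view (a ++ x) f.
Proof. by move=> sx; rewrite -[x]cats0; apply: synchronizes_factor. Qed.

Lemma synchronizes_catr T view x b f :
  synchronizes T view x f -> synchronizes T view (x ++ b) f.
Proof. exact: (@synchronizes_factor _ _ [::]). Qed.

(** Synchronization survives adding letters on either side, so words for the subformulas can be
    concatenated; until may need a further prefix that decides it. *)
Lemma synchronizes_exists T view f : exists x, synchronizes T view x f.
Proof.
elim: f => [a i|f [x sx]|f [x sx] g [z sz]|f [x sx]|f [x sx] g [z sz]].
(* An atom reads only the first letter, which lies in [y] or is [a0]. *)
- by exists [:: a0] => -[|b y] w w' _ _ /=; rewrite /wassign; case: (view i).
- by exists x => y w w' rw rw' /= nf /(sx _ _ _ rw' rw).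
- exists (x ++ z) => y w w' rw rw' /= [Hf|Hg]; [left|right].
    by move: Hf; apply: (synchronizes_catr sx).
  by move: Hg; apply: (synchronizes_catl sz).
(* The letter [a0] absorbs the shift when [y] is empty, leaving [x] intact. *)
- exists (a0 :: x) => y w w' rw rw'; cbn [hsat_body].
  have E v : ashift 1 (wassign view (catw y (catw (a0 :: x) v))) =
             wassign view (catw (drop 1 (rcons y a0)) (catw x v)).
    by rewrite -cat1s catwA -[catw y _]catwA cats1 ashift_wassign wshift_catw ?size_rcons.
  by rewrite !E; apply: sx; apply: (@recurs_factor _ [:: a0] x [::]); rewrite cats0.
pose u := x ++ z.
have sf : synchronizes T view u f by apply: synchronizes_catr.
have sg : synchronizes T view u g by apply: synchronizes_catl.
pose S w h := hsat_body T (wassign view w) h.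
(* Either some word in front of u settles the until formula, whatever follows u,
   or the until formula fails at all words in which u recurs. *)
case: (classic (exists y w, recurs u w /\
    (S (catw y (catw u w)) g \/ ~ S (catw y (catw u w)) f))) => [[y [v [rv Hy]]]|H].
  have settled w : recurs u w -> S (catw y (catw u w)) g \/ ~ S (catw y (catw u w)) f.
    by move=> rw; case: Hy => [/(sg _ _ _ rv rw)|Hf]; [left | right => /(sf _ _ _ rw rv)].
  exists (y ++ u) => s w w' rw rw'; cbn [hsat_body] => -[k [Hg Hf]].
  have ru w1 : recurs (y ++ u) w1 -> recurs u w1.
    by move=> r; apply: (@recurs_factor _ y u [::]); rewrite cats0.
  have Es w1 j : j <= size s -> wshift j (catw s (catw (y ++ u) w1)) =
      catw (drop j s ++ y) (catw u w1).
    by move=> lejs; rewrite wshift_catw // !catwA.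
  have Ey w1 : wshift (size s) (catw s (catw (y ++ u) w1)) = catw y (catw u w1).
    by rewrite -[size s]addn0 wshift_catw_size catwA.
  have tr j h : synchronizes T view u h -> j <= size s ->
      hsat_body T (ashift j (wassign view (catw s (catw (y ++ u) w)))) h ->
      hsat_body T (ashift j (wassign view (catw s (catw (y ++ u) w')))) h.
    by move=> sh lejs; rewrite !ashift_wassign !Es //; apply: sh; apply: ru.
  (* A witness up to [size s] carries over by [tr]. With a later one, [f] holds at [size s], so
     [settled] gives [g] there, and [size s] serves as witness for [w']. *)
  have [leks|ltsk] := leqP k (size s).
    exists k; split; first exact: tr Hg.
    by move=> j ltjk; apply: tr (Hf j ltjk) => //; apply: ltnW (leq_trans ltjk leks).
  exists (size s); split=> [|j ltjs]; last first.
    by apply: tr (Hf j (ltn_trans ltjs ltsk)) => //; apply: ltnW.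
  apply: (tr _ _ sg) => //; rewrite ashift_wassign Ey.
  case: (settled w (ru _ rw)) => // -[].
  by rewrite -Ey /S -ashift_wassign; apply: Hf.
exists u => y w w' rw rw'; cbn [hsat_body] => -[k [Hg _]]; case: H.
(* Any witness of until would be followed by another occurrence of [u], so [g] would hold at a word
   excluded by [H]. *)
have ryw : recurs u (catw y (catw u w)) by do 2!apply: recurs_catw.
have [s [v [rv Ev]]] := recurs_suffix k ryw.
exists s, v; split=> //; left.
by rewrite -Ev /S -ashift_wassign.
Qed.

End Synchronization.

(** * Sentences that cannot detect an inserted gap *)

Section Indistinguishable.
Variables (AP : finType) (n : nat).
Implicit Types (f : hbody AP) (i j : 'I_n) (x y z : seq 'I_n).
Implicit Types (s : tvar -> option 'I_n).

(* The letter Some i is a time at which exactly the i-th trace violates the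
   propositions; None is a time at which no trace does. *)
Definition itrace (v : nat -> option 'I_n) i : trace AP := fun k _ => v k != Some i.

Definition iteam v : team AP := fun t => exists i, t = itrace v i.

Definition iassign s v : assign AP := fun m => omap (itrace v) (s m).

Definition iupd s (q : tvar) i : tvar -> option 'I_n :=
  fun m => if m == q then Some i else s m.

Lemma aupd_iassign s v q i : aupd (iassign s v) q (itrace v i) = iassign (iupd s q i) v.
Proof.
by apply: functional_extensionality => y; rewrite /aupd /iassign /iupd; case: eqP.
Qed.

Lemma hsat_iteam_ex s v q phi : hsat_ (iteam v) (iassign s v) (HEx q phi) <->
  exists i, hsat_ (iteam v) (iassign (iupd s q i) v) phi.
Proof.
split=> [[_ [[i ->] Hi]]|[i Hi]]; first by exists i; rewrite -aupd_iassign.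
exists (itrace v i); rewrite aupd_iassign; split=> //; by exists i.
Qed.

Lemma hsat_iteam_all s v q phi : hsat_ (iteam v) (iassign s v) (HAll q phi) <->
  forall i, hsat_ (iteam v) (iassign (iupd s q i) v) phi.
Proof.
split=> [H i|H _ [i ->]]; last by rewrite aupd_iassign; apply: H.
by rewrite -aupd_iassign; apply: H; exists i.
Qed.

Definition somew (w : nat -> 'I_n) : nat -> option 'I_n := fun k => Some (w k).

Lemma somew_catw x w : somew (catw x w) = catw (map Some x) (somew w).
Proof. exact: catw_map. Qed.

Definition gapped x (w : nat -> 'I_n) := catw (rcons (map Some x) None) (somew w).

Definition iview s : tvar -> option ('I_n -> AP -> bool) :=
  fun m => omap (fun i a _ => a != i) (s m).

Lemma iassign_somew s w : iassign s (somew w) = wassign (iview s) w.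
Proof.
by apply: functional_extensionality => m; rewrite /iassign /wassign /iview; case: (s m).
Qed.

(** No assigned trace has index [j], so all of them read [None] and [Some j] alike; the gapped team
    thus becomes an ordinary word, to which synchronization applies. *)
Lemma iassign_gapped s x w j : (forall m, s m <> Some j) ->
  iassign s (gapped x w) = wassign (iview s) (catw (rcons x j) w).
Proof.
move=> s'j; rewrite -iassign_somew somew_catw map_rcons /gapped -!cats1.
apply: functional_extensionality => y; rewrite /iassign.
case Ey: (s y) => [i|] //=; congr Some.
have neq : j != i by apply/eqP => E; apply: (s'j y); rewrite Ey E.
apply: functional_extensionality => k; apply: functional_extensionality => a.
rewrite /itrace !catwA /=.
by elim: (map _ x) k => [|b l IHl] [|k] //=.
Qed.

(** Allows the gapped and the ungapped team to be replaced by a common one, as [synchronizes] fixes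
    its team. *)
Lemma hsat_body_team T T' f (P : assign AP) : hsat_body T P f <-> hsat_body T' P f.
Proof.
elim: f P => //= [f IHf|f IHf g IHg|f IHf g IHg] P.
- by rewrite IHf.
- by rewrite IHf IHg.
by split=> -[k [/IHg Hg Hf]]; exists k; split=> // k' /Hf /IHf.
Qed.

(* Stable under enlarging x, so that finitely many words x can be combined. *)
Definition gap_blind s (phi : hyper AP) x := forall y z w, recurs x w ->
  hsat_ (iteam (somew (catw (y ++ x ++ z) w))) (iassign s (somew (catw (y ++ x ++ z) w))) phi
  <-> hsat_ (iteam (gapped (y ++ x ++ z) w)) (iassign s (gapped (y ++ x ++ z) w)) phi.

Lemma gap_blind_factor s phi a x b : gap_blind s phi x -> gap_blind s phi (a ++ x ++ b).
Proof.
move=> bx y z w /recurs_factor rw; have := bx (y ++ a) (b ++ z) w rw.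
by rewrite !catA.
Qed.

Lemma gap_blind_all s phi v (l : seq 'I_n) :
  (forall i, exists x, gap_blind (iupd s v i) phi x) ->
  exists x, forall i, i \in l -> gap_blind (iupd s v i) phi x.
Proof.
move=> H; elim: l => [|i l [x bx]]; first by exists [::].
have [z bz] := H i; exists (x ++ z) => j; rewrite inE => /orP[/eqP->|/bx bj].
  by rewrite -[z]cats0; apply: gap_blind_factor.
exact: (@gap_blind_factor _ _ [::] x z).
Qed.

Fixpoint qdepth (phi : hyper AP) : nat :=
  match phi with HEx _ f | HAll _ f => (qdepth f).+1 | HBody _ => 0 end.

(** The list [l] covers the indices already assigned. Each quantifier lengthens it by one and lowers
    [qdepth] by one, so at the body some index [j] is still free. *)
Lemma gap_blind_exists (phi : hyper AP) s (l : seq 'I_n) :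
  (forall m i, s m = Some i -> i \in l) -> size l + qdepth phi < n ->
  exists x, gap_blind s phi x.
Proof.
elim: phi s l => [v f IHf|v f IHf|f] s l sl; rewrite /= ?addnS -?addSn => ltn.
1,2: have [|x bx] := @gap_blind_all s f v (enum 'I_n) _;
  first (move=> i; apply: (IHf _ (i :: l)) => // y j; rewrite /iupd inE;
    by case: eqP => [_ [->]|_ /sl ->]; rewrite ?eqxx ?orbT).
1,2: exists x => y z w rw.
- by rewrite !hsat_iteam_ex; split=> -[i /(bx i (mem_enum _ _) y z w rw)]; exists i.
- by rewrite !hsat_iteam_all; split=> H i; apply/(bx i (mem_enum _ _) y z w rw).
have [j l'j] : exists j, j \notin l.
  apply/existsP; rewrite -negb_forall; apply/forallP => all_l.
  have : #|'I_n| <= #|l| by apply: subset_leq_card; apply/subsetP => i _; apply: all_l.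
  rewrite card_ord => /leq_trans/(_ (card_size l)).
  by rewrite leqNgt -(addn0 (size l)) ltn.
have s'j m : s m <> Some j by move=> /sl; apply/negP.
have [x sx] := synchronizes_exists j (fun=> True) (iview s) f.
exists x => y z w rw; cbn [hsat_].
rewrite !(hsat_body_team _ (fun=> True)) iassign_somew (iassign_gapped _ _ s'j).
(* Both words start with [y] and [x]; the tails are [z] followed by [w], and [z], [j] followed by
   [w], and [x] recurs in both. *)
rewrite -cats1 -!catA !catwA; split; apply: sx; do ?apply: recurs_catw; exact: rw.
Qed.

End Indistinguishable.

Theorem mainTheorem15 (AP : finType) (p : AP) :
  (* (1) *)
  (~ exists phi : ltl AP,
      (forall T : team AP, sat_s T phi <-> hsat T (HEx 0 (HBody (HAP p 0)))) \/
      (forall T : team AP, sat_a T phi <-> hsat T (HEx 0 (HBody (HAP p 0))))) /\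
  (* (2) *)
  (~ exists phi : hyper AP,
      sentence phi /\ forall T : team AP, hsat T phi <-> sat_s T (LF (LAP p))) /\
  (* (3) *)
  ((forall phi : ltl AP, exists psi : hyper AP,
      forall_hyper psi /\ forall T : team AP, sat_a T phi <-> hsat T psi) /\
   (forall psi : hyper AP, forall_hyper psi -> exists phi : ltl AP,
      forall T : team AP, sat_a T phi <-> hsat T psi)).
Proof.
split; last split; last by split; [apply: ltl_to_forall_hyper | apply: forall_hyper_to_ltl].
  case=> phi [] H; have T0 t : ~ ((fun=> False) : team AP) t by [].
    by have /H[t []] := sat_s_empty phi T0.
  by have /H[t []] := sat_a_empty phi T0.
case=> phi [_ H]; pose n := (qdepth phi).+1.
have [|//|x bx] := @gap_blind_exists AP n phi (fun=> None) [::]; first by [].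
have [w rw] := recurs_exists x (ord0 : 'I_n).
have := bx [::] [::] w rw; rewrite cats0 /=.
set u := somew _; set v := gapped _ _.
have E (v' : nat -> option 'I_n) : iassign AP (fun=> None) v' = @empty_assign AP by [].
rewrite !E -![hsat_ _ _ _]/(hsat _ _) !H => -[_ HF].
have [|k Hk] := HF.
  (* The gap stands at time [size x], where every trace satisfies [p]. *)
  exists (size x) => _ [_ [[i ->] ->]]; rewrite /tshift /itrace /v /gapped addn0.
  by rewrite (catwE None) size_rcons size_map ltnSn nth_rcons size_map ltnn eqxx.
(* Without the gap, the trace indexed by the letter at time [k] violates [p] at that time. *)
suff : tshift k (itrace u (catw x w k)) 0 p = true.
  by rewrite /tshift /itrace addn0 /u /somew eqxx.
by apply: Hk; exists (itrace u (catw x w k)); split=> //; exists (catw x w k).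
Qed.
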